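(* For all integers $n,p,r\ge 0$ and all complex numbers $a,d$ with $d\ne 0$, $$S_{p,(a,d)}^{(r)}(n)=\frac{p!\,d^{p}}{(p+r+1)!}\,B_{p+r+1}^{(r+1)}\!\left(\frac{a}{d}+r+n+1\right)-p!\,d^{p}\sum_{k=0}^{r}\binom{n+k}{k}\frac{1}{(p+r+1-k)!}\,B_{p+r+1-k}^{(r-k+1)}\!\left(\frac{a}{d}+r-k\right).$$
   Context: For non-negative integers $n,p,r$ and complex numbers $a,d$ with $d\ne0$, the hyper-sums of powers are defined recursively by $S_{p,(a,d)}^{(0)}(n)=\sum_{i=0}^{n}(a+id)^{p}$ (with the convention $0^0=1$) and, for $r\ge 1$, $S_{p,(a,d)}^{(r)}(n)=\sum_{j=0}^{n}S_{p,(a,d)}^{(r-1)}(j)$. The generalized Bernoulli polynomials $B_{n}^{(\alpha)}(x)$ are defined by $\left(\frac{z}{e^{z}-1}\right)^{\alpha}e^{xz}=\sum_{n\ge 0}B_{n}^{(\alpha)}(x)\frac{z^{n}}{n!}$; here the superscript $(\alpha)$ is a parameter (not a derivative). *)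

(* Defs.v *)
From HB Require Import structures.
From mathcomp Require Import all_boot all_order all_algebra.

Set Implicit Arguments.
Unset Strict Implicit.
Unset Printing Implicit Defensive.

Import Order.TTheory GRing.Theory Num.Theory.

Local Open Scope ring_scope.

(* A formal power series over A is its coefficient sequence: f stands for
   \sum_n f n * z ^ n. *)
Definition fps (A : Type) : Type := nat -> A.

Definition fps_one (A : pzRingType) : fps A := fun n => (n == 0%N)%:R.

Definition fps_mul (A : pzRingType) (f g : fps A) : fps A :=
  fun n => \sum_(i < n.+1) f i * g (n - i)%N.

Definition fps_pow (A : pzRingType) (f : fps A) (m : nat) : fps A :=
  iter m (fps_mul f) (@fps_one A).

(* The first n coefficients of the inverse of f, obtained by solving
   f * g = 1 one coefficient at a time. *)
Fixpoint fps_inv_seq (F : fieldType) (f : fps F) (n : nat) : seq F :=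
  if n is m.+1 then
    let s := fps_inv_seq f m in
    rcons s ((f 0%N)^-1 * (fps_one F m - \sum_(i < m) f (m - i)%N * s`_i))
  else [::].

Definition fps_inv (F : fieldType) (f : fps F) : fps F :=
  fun n => (fps_inv_seq f n.+1)`_n.

(* Since e^z - 1 has no constant term, (e^z - 1) / z is the power series with
   coefficients 1 / (n + 1)!, and z / (e^z - 1) is its inverse. *)
Definition fps_expm1_div_z (F : fieldType) : fps F := fun n => (n.+1`!%:R)^-1.

Definition fps_z_div_expm1 (F : fieldType) : fps F :=
  fps_inv (fps_expm1_div_z F).

(* e^(xz), as a power series in z over the polynomials in x. *)
Definition fps_exp_xz (F : fieldType) : fps {poly F} :=
  fun n => (n`!%:R)^-1 *: 'X^n.

(* B_n^(alpha)(x), as a polynomial in x: n! times the coefficient of z^n in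
   (z / (e^z - 1))^alpha * e^(xz).  The order alpha is a natural number, so the
   power is iterated multiplication. *)
Definition gen_bernoulli (F : fieldType) (alpha n : nat) : {poly F} :=
  n`!%:R *: fps_mul (fun m => (fps_pow (fps_z_div_expm1 F) alpha m)%:P)
                    (fps_exp_xz F) n.

(* S_{p,(a,d)}^{(r)}(n); the convention 0^0 = 1 is that of ^+. *)
Fixpoint hyper_sum (F : pzRingType) (p : nat) (a d : F) (r n : nat) : F :=
  if r is r'.+1 then \sum_(0 <= j < n.+1) hyper_sum p a d r' j
  else \sum_(0 <= i < n.+1) (a + i%:R * d) ^+ p.

Lemma size_fps_inv_seq (F : fieldType) (f : fps F) (n : nat) :
  size (fps_inv_seq f n) = n.
Proof. by elim: n => //= n IHn; rewrite size_rcons IHn. Qed.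

Lemma nth_fps_inv_seq (F : fieldType) (f : fps F) (n i : nat) :
  (i < n)%N -> (fps_inv_seq f n)`_i = fps_inv f i.
Proof.
elim: n => // n IHn; rewrite ltnS leq_eqVlt => /orP[/eqP-> //|lt_in].
by rewrite /= nth_rcons size_fps_inv_seq lt_in IHn.
Qed.

Lemma fps_mulVr (F : fieldType) (f : fps F) :
  f 0%N != 0 -> fps_mul f (fps_inv f) =1 fps_one F.
Proof.
move=> f0 n; rewrite /fps_mul big_ord_recl subn0 {1}/fps_inv /=.
rewrite nth_rcons size_fps_inv_seq ltnn eqxx mulVKf //.
rewrite -[RHS](subrK (\sum_(i < n) f (n - i)%N * (fps_inv_seq f n)`_i)).
congr (_ + _); rewrite (reindex_inj rev_ord_inj) /=.
apply: eq_bigr => i _; rewrite /bump /= add1n.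
by rewrite subnSK // subKn ?(ltnW (ltn_ord i)) // nth_fps_inv_seq.
Qed.

Lemma fps_z_div_expm1P (F : numFieldType) :
  fps_mul (fps_expm1_div_z F) (fps_z_div_expm1 F) =1 fps_one F.
Proof. by apply: fps_mulVr; rewrite invr_eq0 pnatr_eq0. Qed.

(* Main.v *)
Require Import Defs.
From HB Require Import structures.
From mathcomp Require Import all_boot all_order all_algebra.
From mathcomp Require Import ring.
From mathcomp Require Import complex.
From mathcomp Require Import boolp reals.

Set Implicit Arguments.
Unset Strict Implicit.
Unset Printing Implicit Defensive.

Import Order.TTheory GRing.Theory Num.Theory.

Local Open Scope ring_scope.

(* Since (e^z - 1) * (z / (e^z - 1)) = z, the normalised polynomials
   b^(alpha)_m = B^(alpha)_m / m! satisfy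
   b^(alpha+1)_{m+1}(x + 1) - b^(alpha+1)_{m+1}(x) = b^(alpha)_m(x).
   Hence summing b^(r+1)_{p+r+1}(x + r + j + 1) over j <= n telescopes, while
   the correction terms are summed by the hockey-stick identity; the formula
   follows by induction on r from b^(0)_p(x) = x^p / p!. *)

Section PowerSeries.
Variable A : comPzRingType.
Implicit Types f g h : fps A.

Lemma fps_mulC f g : fps_mul f g = fps_mul g f.
Proof.
apply: funext => n; rewrite /fps_mul (reindex_inj rev_ord_inj) /=.
by apply: eq_bigr => i _; rewrite subSS subKn 1?mulrC // -ltnS.
Qed.

Lemma fps_mul1l g : fps_mul (@fps_one A) g = g.
Proof.
apply: funext => n; rewrite /fps_mul big_ord_recl subn0 /fps_one mul1r.
by rewrite big1 ?addr0 // => i _; rewrite mul0r.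
Qed.

End PowerSeries.

(** A coefficient of a product involves only finitely many coefficients of the factors, so
    truncation carries identities over from the polynomial ring. *)
Lemma fps_mul_coef (A : nzRingType) (f g : fps A) (N n : nat) : (n < N)%N ->
  fps_mul f g n = ((\poly_(i < N) f i) * \poly_(i < N) g i)`_n.
Proof.
move=> ltnN; rewrite coefM; apply: eq_bigr => i _.
have le_in : (i <= n)%N by rewrite -ltnS.
by rewrite !coef_poly !(leq_ltn_trans _ ltnN) ?leq_subr.
Qed.

(** Inherited from [{poly A}]: truncating all three series above degree [n] leaves the coefficient
    at [n] unchanged. *)
Lemma fps_mulA (A : nzRingType) (f g h : fps A) :
  fps_mul f (fps_mul g h) = fps_mul (fps_mul f g) h.
Proof.
apply: funext => n.
pose P (u : fps A) := \poly_(i < n.+1) u i.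
transitivity ((P f * (P g * P h))`_n).
  rewrite coefM; apply: eq_bigr => i _; rewrite coef_poly ltn_ord.
  by rewrite (@fps_mul_coef _ g h n.+1) // ltnS leq_subr.
rewrite mulrA coefM; apply: eq_bigr => i _.
by rewrite [(P h)`__]coef_poly ltnS leq_subr (@fps_mul_coef _ f g n.+1).
Qed.

(** The series e^(xz) at a scalar [x]; unlike [fps_exp_xz], its coefficients lie in [F]. *)
Definition fps_exp (F : fieldType) (x : F) : fps F := fun n => x ^+ n / n`!%:R.

(** This is e^((x+1)z) - e^(xz) = z * ((e^z - 1) / z) * e^(xz), the factor z being the index shift.
    The binomial theorem gives it coefficientwise. *)
Lemma fps_exp_addr1 (F : numFieldType) (x : F) (n : nat) :
  fps_exp (x + 1) n.+1 - fps_exp x n.+1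
    = fps_mul (fps_expm1_div_z F) (fps_exp x) n.
Proof.
rewrite /fps_exp exprDn big_ord_recl /= subn0 bin0 expr0 mulr1 mulr1n.
rewrite mulrDl addrAC subrr add0r mulr_suml; apply: eq_bigr => i _.
rewrite /bump add1n subSS expr1n mulr1 /fps_expm1_div_z.
(* The factorial of [n.+1] is replaced by ['C(n.+1, i.+1)] times two smaller factorials, all then
   generalized to nonzero scalars for [field]. *)
have le_in : (i < n.+1)%N := ltn_ord i.
have := bin_fact le_in; rewrite subSS => /(congr1 (fun k => k%:R : F)).
have fact_neq0 k : k`!%:R != 0 :> F by rewrite pnatr_eq0 -lt0n fact_gt0.
rewrite natrM [(_`! * _)%:R]natrM -[_ ^+ _ *+ _]mulr_natr => <-.
have bin_neq0 : 'C(n.+1, i.+1)%:R != 0 :> F by rewrite pnatr_eq0 -lt0n bin_gt0.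
move: bin_neq0 (fact_neq0 i.+1) (fact_neq0 (n - i)%N).
move: 'C(n.+1, i.+1)%:R i.+1`!%:R (n - i)`!%:R => b s t b0 s0 t0.
by field; rewrite b0 s0 t0.
Qed.

(** The normalised value b^(alpha)_m(x), free of the factorial. *)
Definition bernoulli_coef (F : fieldType) (alpha m : nat) (x : F) : F :=
  fps_mul (fps_pow (fps_z_div_expm1 F) alpha) (fps_exp x) m.

Lemma horner_gen_bernoulli (F : numFieldType) (alpha m : nat) (x : F) :
  (gen_bernoulli F alpha m).[x] = m`!%:R * bernoulli_coef alpha m x.
Proof.
rewrite /gen_bernoulli hornerZ horner_sum; congr (_ * _).
apply: eq_bigr => i _; rewrite hornerCM /fps_exp_xz hornerZ hornerXn.
by rewrite /fps_exp [_^-1 * _]mulrC.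
Qed.

Lemma bernoulli_coef0 (F : numFieldType) (m : nat) (x : F) :
  bernoulli_coef 0 m x = x ^+ m / m`!%:R.
Proof. by rewrite /bernoulli_coef /= fps_mul1l. Qed.

(** One of the [alpha.+1] factors z / (e^z - 1) cancels the (e^z - 1) / z produced by
    [fps_exp_addr1]. *)
Lemma bernoulli_coef_diff (F : numFieldType) (alpha m : nat) (x : F) :
  bernoulli_coef alpha.+1 m.+1 (x + 1) - bernoulli_coef alpha.+1 m.+1 x
    = bernoulli_coef alpha m x.
Proof.
have -> : bernoulli_coef alpha m x =
    fps_mul (fps_pow (fps_z_div_expm1 F) alpha.+1)
      (fps_mul (fps_expm1_div_z F) (fps_exp x)) m.
  rewrite /bernoulli_coef /= [fps_mul _ (fps_pow _ _)]fps_mulC -fps_mulA.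
  rewrite [fps_mul (fps_z_div_expm1 F) _]fps_mulA.
  rewrite [fps_mul (fps_z_div_expm1 F) _]fps_mulC.
  by rewrite (funext (fps_z_div_expm1P F)) fps_mul1l.
(* The last summand vanishes because e^((x+1)z) and e^(xz) have the same constant term; the others
   have exponential index at least 1. *)
rewrite /bernoulli_coef /fps_mul -sumrB big_ord_recr /= subnn.
rewrite /fps_exp !expr0 subrr addr0; apply: eq_bigr => i _.
by rewrite -mulrBr subSn ?fps_exp_addr1 // -ltnS.
Qed.

Lemma sum_bernoulli_coef (F : numFieldType) (alpha m n : nat) (x : F) :
  \sum_(0 <= j < n.+1) bernoulli_coef alpha m (x + j%:R)
    = bernoulli_coef alpha.+1 m.+1 (x + n.+1%:R) - bernoulli_coef alpha.+1 m.+1 x.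
Proof.
under eq_bigr do rewrite -bernoulli_coef_diff -addrA natr1.
rewrite (telescope_sumr (fun j => bernoulli_coef alpha.+1 m.+1 (x + j%:R))) //.
by rewrite addr0.
Qed.

Lemma sum_bin_hockey_stick (n k : nat) :
  (\sum_(0 <= j < n.+1) 'C(j + k, k) = 'C(n + k.+1, k.+1))%N.
Proof.
elim: n => [|n IHn]; first by rewrite big_nat1 !add0n !binn.
by rewrite big_nat_recr //= IHn [(n.+1 + k)%N]addSnnS addSn binS.
Qed.

Lemma hyper_sum_bernoulli_coef (F : numFieldType) (n p r : nat) (a d : F) :
  d != 0 ->
  hyper_sum p a d r n = p`!%:R * d ^+ p *
    (bernoulli_coef r.+1 (p + r).+1 (a / d + (r + n).+1%:R)
     - \sum_(k < r.+1) 'C(n + k, k)%:R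
         * bernoulli_coef (r - k).+1 (p + (r - k)).+1 (a / d + (r - k)%:R)).
Proof.
move=> d_neq0; elim: r n => [|r IHr] n.
  rewrite big_ord1 bin0 mul1r subnn addn0 addr0 add0n -sum_bernoulli_coef.
  rewrite /= mulr_sumr; apply: eq_bigr => i _; rewrite bernoulli_coef0.
  (* Factoring out [d] produces both the argument [a / d] and the prefactor [d ^+ p]. *)
  have -> : a + i%:R * d = (a / d + i%:R) * d by rewrite mulrDl divfK.
  have p_neq0 : p`!%:R != 0 :> F by rewrite pnatr_eq0 -lt0n fact_gt0.
  by rewrite exprMn; field.
rewrite [LHS]/=; under eq_bigr do rewrite IHr.
rewrite -mulr_sumr sumrB; congr (_ * _).
(* The argument is regrouped as a base point [a / d + r.+1%:R] plus [j], ready to telescope. The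
   lower endpoint of the telescoped sum is then the new [k = 0] correction term. *)
under eq_bigr do rewrite -[(r + _).+1]addSn natrD addrA.
rewrite sum_bernoulli_coef big_ord_recl /= subn0 bin0 mul1r opprD addrA.
rewrite addnS -[(r.+1 + n).+1]addnS natrD [a / d + (_ + _)]addrA.
congr (_ - _ - _).
(* Only the binomial depends on [j], so the hockey-stick identity moves the old term [k] to the new
   term [k.+1]. *)
rewrite exchange_big /=; apply: eq_bigr => k _.
by rewrite /bump add1n subSS -mulr_suml -natr_sum sum_bin_hockey_stick.
Qed.

Theorem theorem7 (R : realType) (n p r : nat) (a d : R[i]) (hd : d != 0) :
  hyper_sum p a d r n =
    p`!%:R * d ^+ p / (p + r + 1)`!%:R
      * (gen_bernoulli R[i] (r + 1) (p + r + 1)).[a / d + (r + n + 1)%:R]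
    - p`!%:R * d ^+ p
      * \sum_(k < r.+1)
          'C(n + k, k)%:R * (((p + r + 1 - k)`!)%:R)^-1
          * (gen_bernoulli R[i] (r - k + 1) (p + r + 1 - k)).[a / d + (r - k)%:R].
Proof.
have fact_neq0 k : k`!%:R != 0 :> R[i] by rewrite pnatr_eq0 -lt0n fact_gt0.
rewrite hyper_sum_bernoulli_coef // mulrBr !addn1 horner_gen_bernoulli.
rewrite mulrA divfK //; congr (_ - _ * _); apply: eq_bigr => k _.
(* Truncated subtraction: [k <= r] is what makes [p + r + 1 - k] equal to [(p + (r - k)).+1]. *)
have le_kr : (k <= r)%N by rewrite -ltnS.
rewrite horner_gen_bernoulli -mulrA mulKf // !addn1.
by rewrite subSn ?addnBA // (leq_trans le_kr) // leq_addl.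
Qed.
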